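(* Let $\mathcal H$ be a real Hilbert space, let $f:\mathcal H\to\mathbb R$ be convex and continuously differentiable with $\operatorname{argmin}_{\mathcal H} f\neq\emptyset$, let $t_0>0$ and $\alpha\ge 0$. Let $u:[t_0,+\infty[\to\mathcal H$ be a (classical, $\mathcal C^3$) solution of $$\text{(TOGES-V)}\qquad \dddot u(t)+\frac{\alpha+7}{t}\ddot u(t)+\frac{5(\alpha+1)}{t^2}\dot u(t)+\nabla f\Big(u(t)+\tfrac14 t\dot u(t)\Big)=0,\quad t\ge t_0.$$ (a) If $\alpha\ge 3$, then as $t\to+\infty$: (i) $f\big(u(t)+\tfrac14 t\dot u(t)\big)-\inf_{\mathcal H} f=\mathcal O(1/t^3)$; (ii) $f(u(t))-\inf_{\mathcal H} f=\mathcal O(1/t^3)$. (b) If $\alpha>3$, then as $t\to+\infty$: (iii) $f\big(u(t)+\tfrac14 t\dot u(t)\big)-\inf_{\mathcal H} f=o(1/t^3)$; (iv) $f(u(t))-\inf_{\mathcal H} f=o(1/t^3)$; (v) $u(t)$ converges weakly in $\mathcal H$ to some $u_\infty\in\operatorname{argmin}_{\mathcal H} f$.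
   Context: $\dot u,\ddot u,\dddot u$ denote the first, second and third time derivatives of $u$; $\nabla f$ is the gradient of $f$. *)

(* Defs.v *)
From mathcomp Require Import all_boot all_algebra.
From mathcomp Require Import all_classical all_reals all_analysis.
Import GRing.Theory Num.Theory numFieldNormedType.Exports.
Local Open Scope ring_scope.
Local Open Scope classical_set_scope.

(* ip is an inner product on V inducing the norm of V.  Together with the
   completeness of V (V : completeNormedModType R) this makes V a real
   Hilbert space. *)
Definition inner_product {R : realType} {V : normedModType R}
    (ip : V -> V -> R) : Prop :=
  (forall x y, ip x y = ip y x) /\
  (forall (a : R) (x y z : V), ip (a *: x + y) z = a * ip x z + ip y z) /\
  (forall x, ip x x = `|x| ^+ 2).

Definition is_gradient {R : realType} {V : normedModType R}
    (ip : V -> V -> R) (f : V -> R) (g : V -> V) : Prop :=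
  forall x, differentiable f x /\ forall h, 'd f x h = ip (g x) h.

Definition bigO_pinfty {R : realType} (g h : R -> R) : Prop :=
  exists C : R, exists T : R, forall t, T < t -> `|g t| <= C * `|h t|.

Definition littleo_pinfty {R : realType} (g h : R -> R) : Prop :=
  forall eps : R, 0 < eps ->
    exists T : R, forall t, T < t -> `|g t| <= eps * `|h t|.

Definition argmin {R : realType} {V : Type} (f : V -> R) : set V :=
  [set z | forall x, f z <= f x].

(* Main.v *)
(* The shifted trajectory [v t = u t + (t / 4) u' t] solves the second-order
   equation [v'' + ((alpha + 1) / t) v' + (t / 4) grad f (v) = 0].  For a
   minimizer [z] and [3 <= l <= alpha], the energy
     [t^3 / 4 (f (v) - f z) + |l (v - z) + t v'|^2 / 2
        + l (alpha - l) / 2 |v - z|^2]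
   is nonincreasing, which gives the O(1/t^3) rate for [f (v)].  It is affine
   in [l]; if [3 < alpha], both coefficients therefore converge, and the
   constant one, [W = t^3 / 4 (f (v) - f z) + t^2 |v'|^2 / 2], has limit [0]
   because [W / t] is integrable.  Hence the o(1/t^3) rate, the convergence of
   [|v - z|] and, by Opial's argument, the weak convergence of [v].  Finally
   [(t^4 u)' = 4 t^3 v], so [u] is a weighted average of [v] and inherits the
   rates and the weak limit. *)
Require Import Defs.
From mathcomp Require Import all_boot all_order all_algebra.
From mathcomp Require Import all_classical all_reals all_analysis.
From mathcomp Require Import ring lra.
Import Order.TTheory GRing.Theory Num.Theory numFieldNormedType.Exports.
Set Implicit Arguments.
Unset Strict Implicit.
Unset Printing Implicit Defensive.
Local Open Scope ring_scope.
Local Open Scope classical_set_scope.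

(** * Differentiation of curves and of bilinear expressions *)

Lemma is_derive1P {R : realType} {V : normedModType R} (a : R -> V) (t : R) da :
  is_derive t (1 : R) a da <-> h^-1 *: (a (h + t) - a t) @[h --> 0^'] --> da.
Proof.
have E : (fun h : R => h^-1 *: ((a \o shift t) (h *: 1) - a t)) =
         (fun h => h^-1 *: (a (h + t) - a t)).
  by apply/funext => h /=; rewrite [h *: 1]mulr1.
split=> [[d1 d2]|d].
  by rewrite -E -d2; exact: d1.
by split; [apply/cvg_ex; exists da|apply: cvg_lim => //]; rewrite E.
Qed.

Lemma is_derive1_cvg {R : realType} {V : normedModType R} (a : R -> V) (t : R) da :
  is_derive t (1 : R) a da -> a (h + t) @[h --> 0^'] --> a t.
Proof.
move=> [d1 _].
suff : {for 0, continuous (fun h : R => a (h + t))}.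
  by move=> /continuous_withinNx; rewrite add0r.
apply: continuous_comp; first by apply: cvgD; [exact: cvg_id|exact: cvg_cst].
by rewrite add0r; exact/differentiable_continuous/derivable1_diffP.
Qed.

(** The usual splitting of the difference quotient. Bilinearity and continuity are plain hypotheses
    on [B], so that one proof serves both scalar multiplication and an unbundled inner product. *)
Lemma is_derive1_bilin {R : realType} {U V W : normedModType R}
    (B : U -> V -> W) (a : R -> U) (b : R -> V) (t : R) da db :
  (forall x y z, B (x - y) z = B x z - B y z) ->
  (forall x y z, B z (x - y) = B z x - B z y) ->
  (forall k x y, B (k *: x) y = k *: B x y) ->
  (forall k x y, B x (k *: y) = k *: B x y) ->
  (forall (p : R -> U) (q : R -> V) x y, p @ 0^' --> x -> q @ 0^' --> y ->
     B (p h) (q h) @[h --> 0^'] --> B x y) ->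
  is_derive t (1 : R) a da -> is_derive t (1 : R) b db ->
  is_derive t (1 : R) (fun s => B (a s) (b s)) (B da (b t) + B (a t) db).
Proof.
move=> BBl BBr BZl BZr cB Da Db; have cb := is_derive1_cvg Db.
move/is_derive1P: Da => Da; move/is_derive1P: Db => Db.
apply/is_derive1P.
have -> : (fun h => h^-1 *: (B (a (h + t)) (b (h + t)) - B (a t) (b t))) =
    (fun h => B (h^-1 *: (a (h + t) - a t)) (b (h + t)) +
              B (a t) (h^-1 *: (b (h + t) - b t))).
  apply/funext => h; rewrite BZl BZr -scalerDr; congr (_ *: _).
  by rewrite BBl BBr addrA subrK.
by apply: cvgD; apply: cB => //; exact: cvg_cst.
Qed.

Lemma is_derive1_scale {R : realType} {V : normedModType R}
    (a : R -> R) (b : R -> V) (t : R) da db :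
  is_derive t (1 : R) a da -> is_derive t (1 : R) b db ->
  is_derive t (1 : R) (fun s => a s *: b s) (da *: b t + a t *: db).
Proof.
apply: (is_derive1_bilin (B := fun (x : R) (y : V) => x *: y)).
- by move=> *; rewrite scalerBl.
- by move=> *; rewrite scalerBr.
- by move=> *; rewrite scalerA.
- by move=> *; rewrite !scalerA mulrC.
- by move=> *; exact: cvgZ.
Qed.

(** * Inner products, gradients and convexity *)

Section InnerProduct.
Context {R : realType} {V : normedModType R} (ip : V -> V -> R).
Context (ipP : inner_product ip).

Lemma ip_sym x y : ip x y = ip y x.
Proof. by case: ipP. Qed.

Lemma ip_norm x : ip x x = `|x| ^+ 2.
Proof. by case: ipP => _ []. Qed.

Lemma ipZDl a x y z : ip (a *: x + y) z = a * ip x z + ip y z.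
Proof. by case: ipP => _ []. Qed.

Lemma ipDl x y z : ip (x + y) z = ip x z + ip y z.
Proof. by rewrite -[x]scale1r ipZDl mul1r scale1r. Qed.

Lemma ip0l z : ip 0 z = 0.
Proof. by apply: (addrI (ip 0 z)); rewrite -ipDl !addr0. Qed.

Lemma ipZl a x z : ip (a *: x) z = a * ip x z.
Proof. by rewrite -[a *: x]addr0 ipZDl ip0l addr0. Qed.

Lemma ipNl x z : ip (- x) z = - ip x z.
Proof. by rewrite -scaleN1r ipZl mulN1r. Qed.

Lemma ipBl x y z : ip (x - y) z = ip x z - ip y z.
Proof. by rewrite ipDl ipNl. Qed.

Lemma ipDr z x y : ip z (x + y) = ip z x + ip z y.
Proof. by rewrite ![ip z _]ip_sym ipDl. Qed.

Lemma ip0r z : ip z 0 = 0.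
Proof. by rewrite ip_sym ip0l. Qed.

Lemma ipZr a z x : ip z (a *: x) = a * ip z x.
Proof. by rewrite ![ip z _]ip_sym ipZl. Qed.

Lemma ipNr z x : ip z (- x) = - ip z x.
Proof. by rewrite ![ip z _]ip_sym ipNl. Qed.

Lemma ipBr z x y : ip z (x - y) = ip z x - ip z y.
Proof. by rewrite ipDr ipNr. Qed.

Definition ipE := (ipDl, ipDr, ipNl, ipNr, ipZl, ipZr, ip0l, ip0r).

(** Polarization reduces the continuity of [ip] to that of the norm. *)
Lemma ip_polar x y : ip x y = (`|x + y| ^+ 2 - `|x - y| ^+ 2) / 4.
Proof. by rewrite -!ip_norm !ipE (ip_sym y x); field. Qed.

Lemma ip_ge0 x : 0 <= ip x x.
Proof. by rewrite ip_norm sqr_ge0. Qed.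

Lemma ip_eq0 x : ip x x = 0 -> x = 0.
Proof. by rewrite ip_norm => /eqP; rewrite sqrf_eq0 normr_eq0 => /eqP. Qed.

(** Testing against every [w] turns vector identities into scalar ones, which [field] can settle. *)
Lemma ip_ext x y : (forall w, ip x w = ip y w) -> x = y.
Proof.
move=> xy; apply/eqP; rewrite -subr_eq0; apply/eqP/ip_eq0.
by rewrite ipBl xy subrr.
Qed.

Lemma ip_CauchySchwarz x y : `|ip x y| <= `|x| * `|y|.
Proof.
have [->|y0] := eqVneq y 0; first by rewrite ip0r !normr0 mulr0.
have yy : 0 < ip y y by rewrite ip_norm exprn_gt0// normr_gt0.
rewrite -ler_sqr ?nnegrE ?mulr_ge0// -normrX ger0_norm ?sqr_ge0// exprMn -!ip_norm.
(* The expanded square is [ip y y] times the gap between the two sides of the squared inequality. *)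
have := ip_ge0 (ip y y *: x - ip x y *: y).
rewrite !ipE (ip_sym y x) => h.
rewrite -subr_ge0 -(pmulr_rge0 _ yy); apply: le_trans h _.
by rewrite le_eqVlt; apply/orP; left; apply/eqP; ring.
Qed.

Lemma cvg_ip {T : Type} (F : set_system T) {FF : Filter F} (a b : T -> V) x y :
  a @ F --> x -> b @ F --> y -> ip (a t) (b t) @[t --> F] --> ip x y.
Proof.
move=> ax by_; rewrite ip_polar; under eq_fun do rewrite ip_polar.
apply: cvgM; last exact: cvg_cst.
apply: cvgB; rewrite !expr2; apply: cvgM; apply: cvg_norm.
- exact: cvgD. - exact: cvgD. - exact: cvgB. - exact: cvgB.
Qed.

Lemma is_derive1_ip (a b : R -> V) (t : R) da db :
  is_derive t (1 : R) a da -> is_derive t (1 : R) b db ->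
  is_derive t (1 : R) (fun s => ip (a s) (b s)) (ip da (b t) + ip (a t) db).
Proof.
apply: (is_derive1_bilin (B := ip)).
- exact: ipBl.
- by move=> *; exact: ipBr.
- exact: ipZl.
- by move=> *; exact: ipZr.
- by move=> *; exact: cvg_ip.
Qed.

Lemma is_derive1_gradient (f : V -> R) (g : V -> V) (a : R -> V) (t : R) da :
  is_gradient ip f g -> is_derive t (1 : R) a da ->
  is_derive t (1 : R) (fun s => f (a s)) (ip (g (a t)) da).
Proof.
move=> gf [d1 d2]; have [df dfE] := gf (a t).
have da1 : differentiable a t by exact/derivable1_diffP.
have dc : differentiable (f \o a) t by exact: differentiable_comp.
split; first exact/derivable1_diffP.
rewrite deriveE// diff_comp//= dfE; congr ip.
by rewrite -d2 deriveE.
Qed.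

(** By convexity the difference quotients of [f] at [x] along [y - x], with step in []0, 1]], are at
    most [f y - f x]; let the step tend to [0] from the right. *)
Lemma convex_gradient_le (f : V -> R) (g : V -> V) x y :
  convex_function setT f -> is_gradient ip f g ->
  f x + ip (g x) (y - x) <= f y.
Proof.
move=> cf gf; have [df dfE] := gf x.
rewrite -dfE -deriveE// -lerBrDl.
have /cvg_dnbhs_at_right dl := diff_derivable (v := y - x) df.
apply: (cvgr_to_le dl); near=> h.
have h0 : 0 < h by near: h; exact: nbhs_right_gt.
have h1 : h <= 1 by near: h; apply: nbhs_right_le.
have := cf (Itv01 (ltW h0) h1) y x (in_setT _) (in_setT _).
have -> : (conv (Itv01 (ltW h0) h1) (y : convex_lmodType V) x : V) = h *: (y - x) + x.
  by rewrite /conv/= scalerBl scalerBr scale1r addrCA addrC.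
rewrite convRE/= => fh.
rewrite /= [_ *: _]mulrC ler_pdivrMr//; apply: le_trans (lerB fh (lexx _)) _.
by rewrite le_eqVlt; apply/orP; left; apply/eqP; rewrite /unstable.onem; ring.
Unshelve. all: by end_near. Qed.

Lemma norm_le_of_sqr (x : V) (c : R) : 0 <= c -> ip x x <= c ^+ 2 -> `|x| <= c.
Proof. by move=> c0; rewrite ip_norm ler_sqr ?nnegrE. Qed.

End InnerProduct.

(** * Monotone functions on a ray *)

Lemma is_derive1_le0_nincr {R : realType} (g dg : R -> R) (T : R) :
  (forall t, T < t -> is_derive t (1 : R) g (dg t)) ->
  (forall t, T < t -> dg t <= 0) ->
  forall s t, T < s -> s <= t -> g t <= g s.
Proof.
move=> dgE dg0 s t Ts; rewrite le_eqVlt => /orP[/eqP->//|st].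
have inT x : x \in `[s, t]%R -> T < x.
  by rewrite in_itv/= => /andP[sx _]; exact: lt_le_trans sx.
have [c /subset_itv_oo_cc/inT Tc gts] : exists2 c, c \in `]s, t[%R &
    g t - g s = dg c * (t - s).
  apply: MVT => //; first by move=> x /subset_itv_oo_cc/inT/dgE.
  by apply: derivable_within_continuous => x /inT /dgE[].
by rewrite -subr_le0 gts mulr_le0_ge0 ?subr_ge0 ?(ltW st)// dg0.
Qed.

(** The limit is the infimum of the values on the ray. *)
Lemma nonincreasing_ray_cvg {R : realType} (g : R -> R) (T m : R) :
  (forall s t, T < s -> s <= t -> g t <= g s) ->
  (forall t, T < t -> m <= g t) ->
  cvg (g t @[t --> +oo]).
Proof.
move=> gn gm; pose S := [set g t | t in [set t | T < t]].
have hS : has_inf S.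
  split; first by exists (g (T + 1)), (T + 1) => //=; rewrite ltrDl.
  by exists m => _ [t /= Tt <-]; exact: gm.
apply/cvg_ex; exists (inf S); apply/cvgrPdist_le => e e0.
have [_ [s /= Ts <-] gs] := inf_adherent e0 hS.
near=> t.
have st : s <= t by near: t; apply: nbhs_pinfty_ge; rewrite num_real.
have : inf S <= g t.
  by apply: ge_inf; [exact: hS.2|exists t => //=; exact: lt_le_trans st].
have := gn _ _ Ts st.
rewrite ler_distl; move: (inf S) gs => I; lra.
Unshelve. all: by end_near. Qed.

(** * Weak convergence in Hilbert spaces *)

Section Hilbert.
Context {R : realType} {H : completeNormedModType R} (ip : H -> H -> R).
Context (ipP : inner_product ip).

(* The representing vector is the minimizer of [|x|^2 / 2 - L x]: by the
   parallelogram identity the sublevel sets of this functional generate a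
   Cauchy filter. *)
Lemma riesz_representation (L : H -> R) (C : R) :
  (forall a x y, L (a *: x + y) = a * L x + L y) ->
  (forall x, `|L x| <= C * `|x|) ->
  exists x, forall y, L y = ip x y.
Proof.
move=> Llin Lb.
have L0 : L 0 = 0 by have := Llin 1 0 0; rewrite scaler0 addr0; lra.
have LZ a x : L (a *: x) = a * L x by rewrite -[a *: x]addr0 Llin L0 addr0.
have LD x y : L (x + y) = L x + L y by rewrite -[x]scale1r Llin mul1r scale1r.
pose J x := ip x x / 2 - L x.
have JC x : - (C ^+ 2 / 2) <= J x.
  have := ler_normlW (Lb x); rewrite /J (ip_norm ipP).
  have := sqr_ge0 (`|x| - C); nra.
have hJ : has_inf (range J).
  by split; [exists (J 0), 0|exists (- (C ^+ 2 / 2)) => _ [x _ <-]].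
pose m := inf (range J).
have Jm x : m <= J x by apply: ge_inf; [exact: hJ.2|exists x].
pose F := filter_from [set e : R | 0 < e] (fun e => [set x | J x <= m + e]).
have FF : Filter F.
  apply: filter_from_filter; first by exists 1 => /=.
  move=> e1 e2 /= e10 e20; exists (Num.min e1 e2); first by rewrite /= lt_min e10.
  by move=> x /=; rewrite -lerBlDl le_min => /andP[h1 h2]; rewrite -!lerBlDl.
have PF : ProperFilter F.
  apply: filter_from_proper => e /= e0.
  by have [_ [x _ <-] Jx] := inf_adherent e0 hJ; exists x; exact: ltW.
have cF : cauchy F.
  apply: cauchy_exP => e e0.
  (* Since [|x - y|^2 / 4 = J x + J y - 2 J ((x + y) / 2)], two points within [d] of the infimum
     satisfy [|x - y|^2 <= 8 d], which is [e^2 / 2] for [d = e^2 / 16]. *)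
  have d0 : 0 < e ^+ 2 / 16 by rewrite divr_gt0// exprn_gt0.
  have [_ [x _ <-] Jx] := inf_adherent d0 hJ; exists x.
  exists (e ^+ 2 / 16) => //= y /= Jy.
  rewrite -ball_normE /= -ltr_sqr ?nnegrE ?(ltW e0)// -(ip_norm ipP).
  have := Jm (2^-1 *: (x + y)); move: Jx Jy d0; rewrite -/m /J LZ LD !(ipE ipP).
  rewrite (ip_sym ipP y x); lra.
have /cvg_ex[x Fx] : cvg F by apply: cauchy_cvg.
have {}Fx : id y @[y --> F] --> x by exact: Fx.
have LF : L y @[y --> F] --> L x.
  have C0 : 0 < `|C| + 1 by rewrite ltr_wpDl.
  apply/cvgrPdist_le => e e0.
  have e1 : 0 < e / (`|C| + 1) by rewrite divr_gt0.
  move/cvgrPdist_le: (Fx) => /(_ _ e1); apply: filterS => y xy.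
  have -> : L x - L y = L (x - y) by rewrite LD -(scaleN1r y) LZ mulN1r.
  apply: le_trans (Lb _) _.
  apply: (@le_trans _ _ ((`|C| + 1) * `|x - y|)).
    by rewrite ler_wpM2r//; have := ler_norm C; lra.
  by rewrite mulrC -ler_pdivlMr.
have JF : J y @[y --> F] --> J x.
  apply: cvgB => //; apply: cvgM; last exact: cvg_cst.
  by apply: (cvg_ip ipP).
have Jx : J x <= m.
  apply/ler_addgt0Pr => e e0; apply: (cvgr_to_le JF).
  by exists e.
exists x => y.
have Q s : 0 <= s * (ip x y - L y) + s ^+ 2 * (ip y y / 2).
  have := le_trans Jx (Jm (x + s *: y)).
  rewrite /J LD LZ !(ipE ipP) (ip_sym ipP y x); nra.
(* A nearly optimal [s] in the quadratic [Q]; the [+ 1] keeps the denominator positive when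
   [y = 0]. *)
have := Q (- (ip x y - L y) / (ip y y + 1)).
have := ip_ge0 ipP y; set d := ip x y - L y; set q := ip y y => q0.
have q1 : 0 < q + 1 by lra.
rewrite -(pmulr_rge0 _ (exprn_gt0 2 q1)).
have -> : (q + 1) ^+ 2 * (- d / (q + 1) * d + (- d / (q + 1)) ^+ 2 * (q / 2)) =
   - (d ^+ 2 * (q / 2 + 1)) by field; rewrite gt_eqF.
rewrite oppr_ge0 => dq.
have : d ^+ 2 <= 0 by have := sqr_ge0 d; nra.
move=> d2; have /eqP : d ^+ 2 == 0 by rewrite eq_le d2 sqr_ge0.
by move/eqP; rewrite sqrf_eq0 subr_eq0 => /eqP ->.
Qed.

(** A compact interval provides a cluster point, and an ultrafilter converges to each of its cluster
    points. *)
Lemma ultra_bounded_cvg {T : Type} (G : set_system T) {GU : UltraFilter G}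
    (h : T -> R) (K : R) :
  (\forall t \near G, `|h t| <= K) -> cvg (h t @[t --> G]).
Proof.
move=> hK; have [p [_ clp]] : `[- K, K]%classic `&` cluster (h @ G) !=set0.
  apply: (@segment_compact R (- K) K).
  by apply: filterS hK => t /=; rewrite in_itv/= ler_norml.
apply/cvg_ex; exists p => A Ap.
have [//|GC] := in_ultra_setVsetC (h @^-1` A) GU.
by have [r [/= rA /rA]] := clp (~` A) A GC Ap.
Qed.

(** Weak compactness of balls in ultrafilter form: the limits of [ip (v t) y] define a linear
    functional of [y] bounded by [M], which Riesz representation turns into a vector. *)
Lemma ultra_bounded_weak_cvg {T : Type} (G : set_system T) {GU : UltraFilter G}
    (v : T -> H) (M : R) :
  (\forall t \near G, `|v t| <= M) ->
  exists x, forall y, ip (v t) y @[t --> G] --> ip x y.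
Proof.
move=> vM.
have bnd y : \forall t \near G, `|ip (v t) y| <= M * `|y|.
  apply: filterS vM => t vt; apply: le_trans (ip_CauchySchwarz ipP _ _) _.
  exact: ler_wpM2r.
have lG y : ip (v t) y @[t --> G] --> lim (ip (v t) y @[t --> G]).
  exact: ultra_bounded_cvg (bnd y).
have [x xE] : exists x, forall y, lim (ip (v t) y @[t --> G]) = ip x y.
  apply: (@riesz_representation _ M) => [a x y|x].
    apply: cvg_lim => //.
    under eq_fun do rewrite (ipDr ipP) (ipZr ipP).
    by apply: cvgD => //; apply: cvgM => //; exact: cvg_cst.
  exact: cvgr_to_le (cvg_norm (lG x)) (bnd x).
by exists x => y; rewrite -xE.
Qed.

(** Every ultrafilter refining [F] has a weak limit in [S], and convergence of the distances to
    points of [S] forces two such limits to coincide. *)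
Lemma opial {T : Type} (F : set_system T) {FF : ProperFilter F}
    (S : set H) (v : T -> H) (M : R) :
  (\forall t \near F, `|v t| <= M) ->
  (forall z, S z -> cvg (ip (v t - z) (v t - z) @[t --> F])) ->
  (forall (G : set_system T) x, UltraFilter G -> F `<=` G ->
     (forall y, ip (v t) y @[t --> G] --> ip x y) -> S x) ->
  exists2 x, S x & forall y, ip (v t) y @[t --> F] --> ip x y.
Proof.
move=> vM vS clS.
have wl (G : set_system T) : UltraFilter G -> F `<=` G ->
    exists2 x, S x & forall y, ip (v t) y @[t --> G] --> ip x y.
  move=> GU FG; have [x xG] := ultra_bounded_weak_cvg (FG _ vM).
  by exists x => //; exact: clS xG.
have [G [GU FG]] := ultraFilterLemma FF.
have [x Sx xG] := wl G GU FG.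
exists x => // y A Ay; apply: contrapT => nFA.
(* If [A] fails along [F], then [F] restricted to [D] is still proper. An ultrafilter finer than it
   has a weak limit [x']; once [x = x'], this ultrafilter contains both [D] and its complement. *)
pose D := [set t | ~ A (ip (v t) y)].
have PD : ProperFilter (within D F).
  apply: Build_ProperFilter_ex => B FB.
  apply: contrapT => B0; apply: nFA.
  have {}FB : \forall t \near F, D t -> B t by exact: FB.
  by apply: filterS FB => t DB; apply: contrapT => /DB Bt; apply: B0; exists t.
have [G' [GU' DG']] := ultraFilterLemma PD.
have FG' : F `<=` G' by move=> B FB; apply: DG'; apply: filterS FB => t Bt _.
have [x' Sx' xG'] := wl G' GU' FG'.
(* [|v - x|^2 - |v - x'|^2] converges, hence so does [<v, x - x'>]. *)
have /cvg_ex[l Fl] : cvg (ip (v t) (x - x') @[t --> F]).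
  have /cvg_ex[p Fp] := vS _ Sx; have /cvg_ex[q Fq] := vS _ Sx'.
  apply/cvg_ex; exists ((q - p + (ip x x - ip x' x')) / 2).
  have -> : (fun t => ip (v t) (x - x')) = (fun t =>
      (ip (v t - x') (v t - x') - ip (v t - x) (v t - x) +
       (ip x x - ip x' x')) / 2).
    apply/funext => t.
    by rewrite !(ipE ipP) (ip_sym ipP x (v t)) (ip_sym ipP x' (v t)); field.
  by apply: cvgM (cvg_cst _); apply: cvgD (cvg_cst _); exact: cvgB.
have lx : l = ip x (x - x').
  by apply: (cvg_unique _ _ (xG _)) => // B /Fl /FG.
have lx' : l = ip x' (x - x').
  by apply: (cvg_unique _ _ (xG' _)) => // B /Fl /FG'.
have /(ip_eq0 ipP)/eqP : ip (x - x') (x - x') = 0.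
  by rewrite (ipBl ipP) -lx -lx' subrr.
rewrite subr_eq0 => /eqP xx'; rewrite xx' in Ay.
have G1 : \forall t \near G', A (ip (v t) y) by exact: xG' Ay.
have G2 : G' D by apply: DG'; exact: withinT.
by have [t [/= At /(_ At)]] := filter_ex (filterI G1 G2).
Qed.

End Hilbert.

(** * Weighted averages *)

Section ScalarDerivatives.
Context {R : realType}.
Implicit Types (a b : R -> R) (t c : R).

Lemma is_derive1_mul a b t da db :
  is_derive t (1 : R) a da -> is_derive t (1 : R) b db ->
  is_derive t (1 : R) (fun s => a s * b s) (da * b t + a t * db).
Proof. exact: is_derive1_scale. Qed.

Lemma is_derive1_add {V : normedModType R} (a b : R -> V) t da db :
  is_derive t (1 : R) a da -> is_derive t (1 : R) b db ->
  is_derive t (1 : R) (fun s => a s + b s) (da + db).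
Proof. exact: is_deriveD. Qed.

Lemma is_derive1_sub_cst {V : normedModType R} (a : R -> V) t da (c : V) :
  is_derive t (1 : R) a da -> is_derive t (1 : R) (fun s => a s - c) da.
Proof.
move=> Da; rewrite -[da]addr0; apply: is_derive1_add => //; exact: is_derive_cst.
Qed.

Lemma is_derive1_monomial n c t :
  is_derive t (1 : R) (fun s => c * s ^+ n) (c * (n%:R * t ^+ n.-1)).
Proof.
have D : is_derive t (1 : R) (fun s : R => s ^+ n) (n%:R * t ^+ n.-1).
  by split; [exact: exprn_derivable|rewrite exp_derive [_ *: 1]mulr1].
have := is_derive1_mul (is_derive_cst c t (1 : R)) D.
by rewrite /cst mul0r add0r.
Qed.

Lemma is_derive1_le_cst a da (T c : R) :
  (forall t, T < t -> is_derive t (1 : R) a (da t)) ->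
  (forall t, T < t -> da t <= c) ->
  forall s t, T < s -> s <= t -> a t <= a s + c * (t - s).
Proof.
move=> Da dac s t Ts st.
have : a t + - c * t ^+ 1 <= a s + - c * s ^+ 1.
  apply: (@is_derive1_le0_nincr _ (fun r => a r + - c * r ^+ 1)
            (fun r => da r + - c * (1%:R * r ^+ 0)) T _ _ _ _ Ts st) => r Tr.
    by apply: is_derive1_add; [exact: Da|exact: is_derive1_monomial].
  by have := dac _ Tr; rewrite expr0; lra.
rewrite !expr1; lra.
Qed.

(* [phi] is the average of [psi] with weight [4 t^3]:
   [(t^4 (phi - c))' = 4 t^3 (psi - c)]. *)
Lemma average_le (phi psi dphi : R -> R) (T c e : R) :
  0 <= T ->
  (forall t, T < t -> is_derive t (1 : R) phi (dphi t)) ->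
  (forall t, T < t -> phi t + t / 4 * dphi t = psi t) ->
  (forall t, T < t -> psi t <= c) -> 0 < e ->
  exists T', forall t, T' < t -> phi t <= c + e.
Proof.
move=> T0 Dphi phiE psic e0.
have N s t : T < s -> s <= t ->
    1 * t ^+ 4 * (phi t - c) <= 1 * s ^+ 4 * (phi s - c).
  apply: (@is_derive1_le0_nincr _ (fun r => 1 * r ^+ 4 * (phi r - c))
    (fun r => 1 * (4%:R * r ^+ 3) * (phi r - c) + 1 * r ^+ 4 * dphi r)) => r Tr.
    apply: is_derive1_mul; first exact: is_derive1_monomial.
    by apply: is_derive1_sub_cst; exact: Dphi.
  have r0 : 0 < r by lra.
  have -> : 1 * (4%:R * r ^+ 3) * (phi r - c) + 1 * r ^+ 4 * dphi r =
    4 * r ^+ 3 * (psi r - c) by rewrite -phiE//; field.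
  by rewrite pmulr_rle0 ?mulr_gt0 ?exprn_gt0// subr_le0 psic.
pose s := T + 1; pose K := 1 * s ^+ 4 * (phi s - c).
(* Beyond this threshold [K <= e * t <= e * t^4], the last inequality because [t >= 1]. *)
exists (Num.max s (Num.max 1 (`|K| / e))) => t.
rewrite !gt_max => /and3P[st t1 tK].
have Ts : T < s by rewrite ltrDl.
have := N s t Ts (ltW st); rewrite -/K mul1r => tc.
have t0 : 0 < t by lra.
have t4 : t <= t ^+ 4 by rewrite ler_eXnr ?ltW.
rewrite -lerBlDl -(ler_pM2l (exprn_gt0 4 t0)).
apply: le_trans tc _; apply: le_trans (ler_norm _) _.
move: tK; rewrite ltr_pdivrMr// => /ltW /le_trans; apply.
by rewrite ler_pM2r.
Qed.

(** [average_le] applied to [phi] and to [- phi], half of the tolerance being spent on [psi] and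
    half on the averaging. *)
Lemma average_cvg (phi psi dphi : R -> R) (T l : R) :
  0 <= T ->
  (forall t, T < t -> is_derive t (1 : R) phi (dphi t)) ->
  (forall t, T < t -> phi t + t / 4 * dphi t = psi t) ->
  psi t @[t --> +oo] --> l -> phi t @[t --> +oo] --> l.
Proof.
move=> T0 Dphi phiE /cvgrPdist_le psil; apply/cvgrPdist_le => e e0.
have e2 : 0 < e / 2 by lra.
have [T1 [_ HT1]] := psil _ e2.
pose S := Num.max T T1.
have ST t : S < t -> T < t by rewrite gt_max => /andP[].
have S1 t : S < t -> `|l - psi t| <= e / 2.
  by rewrite gt_max => /andP[_ /HT1].
have S0 : 0 <= S by rewrite le_max T0.
have [A HA] : exists T', forall t, T' < t -> phi t <= (l + e / 2) + e / 2.
  apply: (average_le S0 (fun t h => Dphi t (ST t h))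
    (fun t h => phiE t (ST t h))) => // t /S1.
  by rewrite ler_distl; lra.
have [B HB] : exists T', forall t, T' < t -> - phi t <= (- l + e / 2) + e / 2.
  apply: (@average_le (fun t => - phi t) (fun t => - psi t) (fun t => - dphi t) S) => //.
  - by move=> t /ST /Dphi D; exact: is_deriveN.
  - by move=> t /ST /phiE <-; ring.
  - by move=> t /S1; rewrite ler_distl; lra.
near=> t.
have /HA : A < t by near: t; apply: nbhs_pinfty_gt; rewrite num_real.
have /HB : B < t by near: t; apply: nbhs_pinfty_gt; rewrite num_real.
rewrite ler_distl; lra.
Unshelve. all: by end_near. Qed.

End ScalarDerivatives.

(** * Energy estimates *)

Section Dynamics.
Context {R : realType} {H : completeNormedModType R} (ip : H -> H -> R).
Context (f : H -> R) (g : H -> H).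
Context (ipP : inner_product ip) (cf : convex_function setT f).
Context (gf : is_gradient ip f g).
Context (v v1 v2 : R -> H) (T alpha : R) (T0 : 0 <= T).
Context (Dv : forall t, T < t -> is_derive t (1 : R) v (v1 t)).
Context (Dv1 : forall t, T < t -> is_derive t (1 : R) v1 (v2 t)).
Context (ode : forall t, T < t ->
  t *: v2 t + (alpha + 1) *: v1 t + (t ^+ 2 / 4) *: g (v t) = 0).

Let tgt0 t : T < t -> 0 < t.
Proof. exact: le_lt_trans. Qed.

(* The factors [1 *] and [^+ 1] match [is_derive1_monomial]. *)
Definition mechanical (z : H) (t : R) : R :=
  1 / 4 * t ^+ 3 * (f (v t) - f z) + 1 / 2 * t ^+ 2 * ip (v1 t) (v1 t).

Definition anchor (z : H) (t : R) : R :=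
  1 * t ^+ 1 * ip (v t - z) (v1 t) + alpha / 2 * ip (v t - z) (v t - z).

(* Expanding the square,
   [energy z l t = t^3 / 4 (f (v t) - f z) + |l (v t - z) + t v1 t|^2 / 2
                   + l (alpha - l) / 2 |v t - z|^2]. *)
Definition energy (z : H) (l t : R) : R := mechanical z t + l * anchor z t.

(** Pairing the equation with [t *: v1 t] eliminates both the acceleration and the gradient, leaving
    [1 - (alpha + 1) = - alpha] as the coefficient of [t |v1|^2]. *)
Lemma is_derive_mechanical z t : T < t ->
  is_derive t (1 : R) (mechanical z)
    (3 / 4 * t ^+ 2 * (f (v t) - f z) - alpha * t * ip (v1 t) (v1 t)).
Proof.
move=> Tt; rewrite /mechanical.
have Df := is_derive1_sub_cst (f z) (is_derive1_gradient gf (Dv Tt)).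
have Dn := is_derive1_ip ipP (Dv1 Tt) (Dv1 Tt).
apply: is_derive_eq (is_derive1_add
  (is_derive1_mul (is_derive1_monomial 3 (1 / 4) t) Df)
  (is_derive1_mul (is_derive1_monomial 2 (1 / 2) t) Dn)) _.
have /(congr1 (ip (v1 t))) := ode Tt; rewrite !(ipE ipP) => E.
rewrite /= (ip_sym ipP (v2 t)) (ip_sym ipP (g _)).
move: E; set A := ip (v1 t) (v2 t); set B := ip _ (v1 t); set C := ip _ (g _).
by move=> E; rewrite -[RHS]addr0 -(mulr0 t) -E; field.
Qed.

(** With the weight [alpha / 2] the terms in [ip (v t - z) (v1 t)] add up to [alpha + 1], exactly
    the friction term of the equation paired with [v t - z]. *)
Lemma is_derive_anchor z t : T < t ->
  is_derive t (1 : R) (anchor z)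
    (t * ip (v1 t) (v1 t) - 1 / 4 * t ^+ 2 * ip (g (v t)) (v t - z)).
Proof.
move=> Tt.
have Dvz := is_derive1_sub_cst z (Dv Tt).
apply: is_derive_eq (is_derive1_add
  (is_derive1_mul (is_derive1_monomial 1 1 t) (is_derive1_ip ipP Dvz (Dv1 Tt)))
  (is_derive1_mul (is_derive_cst (alpha / 2) t (1 : R))
     (is_derive1_ip ipP Dvz Dvz))) _.
have /(congr1 (ip (v t - z))) := ode Tt.
move: (v t - z) => w; rewrite !(ipE ipP) => E.
rewrite /= (ip_sym ipP (g _)) (ip_sym ipP (v1 t) w).
by rewrite mul0r add0r -[RHS]addr0 -E; field.
Qed.

Definition energy_rate (z : H) (l t : R) : R :=
  (3 / 4 * t ^+ 2 * (f (v t) - f z) - alpha * t * ip (v1 t) (v1 t)) +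
  l * (t * ip (v1 t) (v1 t) - 1 / 4 * t ^+ 2 * ip (g (v t)) (v t - z)).

Lemma is_derive_energy z l t : T < t ->
  is_derive t (1 : R) (energy z l) (energy_rate z l t).
Proof.
move=> Tt; apply: is_derive1_add; first exact: is_derive_mechanical.
by apply: is_deriveZ; exact: is_derive_anchor.
Qed.

(** The gradient inequality at [v t], multiplied by [l * t^2 / 4], changes the coefficient [3] of
    the gap into [3 - l]. Both terms then have the right sign when [3 <= l <= alpha]. *)
Lemma energy_rate_le z l t : T < t -> 0 <= l ->
  energy_rate z l t <= - ((l - 3) * (t ^+ 2 / 4 * (f (v t) - f z)) +
                          (alpha - l) * (t * ip (v1 t) (v1 t))).
Proof.
move=> Tt l0; have := convex_gradient_le (v t) z cf gf.
rewrite -[z - v t]opprB (ipNr ipP) => fz.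
have : 0 <= l * (t ^+ 2 / 4) * (ip (g (v t)) (v t - z) - (f (v t) - f z)).
  rewrite mulr_ge0//; first by rewrite mulr_ge0// divr_ge0// sqr_ge0.
  lra.
rewrite /energy_rate -subr_ge0 => h; rewrite -subr_ge0; apply: le_trans h _.
by rewrite le_eqVlt; apply/orP; left; apply/eqP; field.
Qed.

Section Anchored.
Context (z : H) (zmin : argmin f z).

Let gap_ge0 t : 0 <= f (v t) - f z.
Proof. by rewrite subr_ge0. Qed.

Lemma mechanical_ge_gap t : T < t -> t ^+ 3 * (f (v t) - f z) <= 4 * mechanical z t.
Proof.
move=> Tt; have : 0 <= t ^+ 2 * ip (v1 t) (v1 t).
  by rewrite mulr_ge0// ?sqr_ge0// (ip_ge0 ipP).
by rewrite /mechanical; lra.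
Qed.

Lemma mechanical_ge_speed t : T < t -> t ^+ 2 * ip (v1 t) (v1 t) <= 2 * mechanical z t.
Proof.
move=> Tt; have : 0 <= t ^+ 3 * (f (v t) - f z).
  by rewrite mulr_ge0// exprn_ge0// ltW// tgt0.
by rewrite /mechanical; lra.
Qed.

Lemma mechanical_ge0 t : T < t -> 0 <= mechanical z t.
Proof.
move=> Tt; have : 0 <= t ^+ 2 * ip (v1 t) (v1 t).
  by rewrite mulr_ge0// ?sqr_ge0// (ip_ge0 ipP).
by have := mechanical_ge_speed Tt; lra.
Qed.

(** Drops the nonnegative term [|l (v - z) + t v1|^2 / 2] of the energy. *)
Lemma energy_ge l t : T < t ->
  t ^+ 3 / 4 * (f (v t) - f z) + l * (alpha - l) / 2 * ip (v t - z) (v t - z)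
  <= energy z l t.
Proof.
move=> Tt; have := ip_ge0 ipP (l *: (v t - z) + t *: v1 t).
rewrite (ipDl ipP) !(ipDr ipP (_ *: _)) !(ipZl ipP) !(ipZr ipP).
rewrite (ip_sym ipP (v1 t) (v t - z)) /energy /mechanical /anchor.
set A := ip _ _; set B := ip _ _; set C := ip _ _; set F := f _ - _ => h.
rewrite -subr_ge0; apply: (@le_trans _ _
  ((l * (l * A) + l * (t * B) + (t * (l * B) + t * (t * C))) / 2)).
  by rewrite divr_ge0//; lra.
by rewrite le_eqVlt; apply/orP; left; apply/eqP; field.
Qed.

Lemma energy_ge0 l t : T < t -> 0 <= l <= alpha -> 0 <= energy z l t.
Proof.
move=> Tt /andP[l0 la]; apply: le_trans (energy_ge l Tt).
rewrite addr_ge0// mulr_ge0//.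
- by rewrite divr_ge0// exprn_ge0// ltW// tgt0.
- by rewrite divr_ge0// mulr_ge0// subr_ge0.
- exact: ip_ge0.
Qed.

Lemma energy_nincr l : 3 <= l <= alpha ->
  forall s t, T < s -> s <= t -> energy z l t <= energy z l s.
Proof.
move=> /andP[l3 la].
apply: (@is_derive1_le0_nincr _ (energy z l) (energy_rate z l)) => t Tt.
  exact: is_derive_energy.
apply: le_trans (energy_rate_le z Tt _) _; first by lra.
rewrite oppr_le0 addr_ge0// mulr_ge0 ?subr_ge0//.
- by rewrite mulr_ge0 ?subr_ge0// divr_ge0// sqr_ge0.
- by rewrite mulr_ge0 ?(ip_ge0 ipP)// ltW// tgt0.
Qed.

Lemma gap_bigO : 3 <= alpha ->
  exists C, forall t, T + 1 <= t -> t ^+ 3 * (f (v t) - f z) <= C.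
Proof.
(* The reference time is [T + 1] because the hypotheses hold only strictly beyond [T]. *)
move=> a3; exists (4 * energy z 3 (T + 1)) => t tT.
have T1 : T < T + 1 by rewrite ltrDl.
have := @energy_nincr 3 _ (T + 1) t T1 tT; rewrite lexx a3 => /(_ isT).
have := energy_ge 3 (lt_le_trans T1 tT).
have : 0 <= 3 * (alpha - 3) / 2 * ip (v t - z) (v t - z).
  by rewrite mulr_ge0 ?(ip_ge0 ipP)//; lra.
lra.
Qed.

Lemma energy_cvg l : 3 <= l <= alpha -> cvg (energy z l t @[t --> +oo]).
Proof.
move=> la; apply: (@nonincreasing_ray_cvg _ _ T 0); first exact: energy_nincr.
by move=> t Tt; apply: energy_ge0 => //; lra.
Qed.

(* [energy z l] is affine in [l], so its convergence for two values of [l]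
   gives the convergence of both coefficients. *)
Lemma mechanical_anchor_cvg : 3 < alpha ->
  cvg (mechanical z t @[t --> +oo]) /\ cvg (anchor z t @[t --> +oo]).
Proof.
move=> a3.
have /cvg_ex[p Ep] : cvg (energy z 3 t @[t --> +oo]) by apply: energy_cvg; lra.
have /cvg_ex[q Eq] : cvg (energy z alpha t @[t --> +oo]).
  by apply: energy_cvg; lra.
have a0 : alpha - 3 != 0 by rewrite subr_eq0 gt_eqF.
split; apply/cvg_ex.
  exists ((alpha * p - 3 * q) / (alpha - 3)).
  have -> : mechanical z = fun t =>
      (alpha * energy z 3 t - 3 * energy z alpha t) / (alpha - 3).
    by apply/funext => t; rewrite /energy; field.
  by apply: cvgM (cvg_cst _); apply: cvgB; apply: cvgM => //; exact: cvg_cst.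
exists ((q - p) / (alpha - 3)).
have -> : anchor z = fun t => (energy z alpha t - energy z 3 t) / (alpha - 3).
  by apply/funext => t; rewrite /energy; field.
by apply: cvgM (cvg_cst _); exact: cvgB.
Qed.

(* Along the energy at the midpoint of [3] and [alpha], [mechanical / t] is
   integrable, which a positive limit would contradict. *)
Lemma mechanical_cvg0 : 3 < alpha -> mechanical z t @[t --> +oo] --> 0.
Proof.
move=> a3; have /cvg_ex[w Ew] := (mechanical_anchor_cvg a3).1.
have w0 : 0 <= w.
  apply: (cvgr_to_ge Ew); near=> t; apply: mechanical_ge0.
  by near: t; apply: nbhs_pinfty_gt; rewrite num_real.
suff w00 : w <= 0 by have -> : 0 = w by lra.
rewrite leNgt; apply/negP => wpos.
pose l := (3 + alpha) / 2; pose d := (alpha - 3) / 2.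
have d0 : 0 < d by rewrite /d; lra.
have [S [_ HS]] : \forall t \near +oo, w / 2 <= mechanical z t.
  by apply: (cvgr_ge _ Ew); lra.
pose c := d * (w / 2); have c0 : 0 < c by rewrite mulr_gt0//; lra.
pose S' := Num.max T S.
have ST t : S' < t -> T < t by rewrite gt_max => /andP[].
(* At the midpoint [l - 3 = alpha - l = d], so the energy rate is at most [- d * mechanical / t],
   hence at most [- c / t] where [mechanical >= w / 2]. The logarithm is the integral of this
   bound. *)
have N : forall s t, S' < s -> s <= t ->
    energy z l t + c * ln t <= energy z l s + c * ln s.
  apply: (@is_derive1_le0_nincr _ (fun t => energy z l t + c * ln t)
    (fun t => energy_rate z l t + c * t^-1)) => t St.
    have t0 : 0 < t by exact/tgt0/ST.
    apply: is_derive1_add; first by apply/is_derive_energy/ST.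
    by apply: is_deriveZ; exact: is_derive1_ln.
  have Tt := ST _ St; have t0 := tgt0 Tt.
  have Wt : w / 2 <= mechanical z t by apply: HS; move: St; rewrite gt_max => /andP[].
  have l0 : 0 <= l by rewrite /l; lra.
  have := energy_rate_le z Tt l0.
  have -> : alpha - l = d by rewrite /l /d; field.
  have -> : l - 3 = d by rewrite /l /d; field.
  have : c * t^-1 <= d * (t ^+ 2 / 4 * (f (v t) - f z)) + d * (t * ip (v1 t) (v1 t)).
    rewrite ler_pdivrMr// -mulrDr /c -[leRHS]mulrA ler_pM2l//.
    apply: le_trans Wt _; rewrite /mechanical -subr_ge0.
    have : 0 <= 1 / 2 * t ^+ 2 * ip (v1 t) (v1 t).
      by rewrite mulr_ge0 ?(ip_ge0 ipP)// mulr_ge0// sqr_ge0.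
    move/le_trans; apply.
    by rewrite le_eqVlt; apply/orP; left; apply/eqP; field.
  lra.
pose s := S' + 1; have Ss : S' < s by rewrite ltrDl.
have s0 : 0 < s by exact/tgt0/ST.
(* Chosen so that the energy would be at most [-1] at time [s * expR A], contradicting its
   nonnegativity. *)
pose A := (energy z l s + 1) / c.
have Es : 0 <= energy z l s by apply: energy_ge0; [exact: ST|rewrite /l; lra].
have A0 : 0 <= A by rewrite divr_ge0//; lra.
have eA : 1 <= expR A by rewrite -[leLHS]expR0 ler_expR.
have st : s <= s * expR A by rewrite ler_peMr // ltW.
have := N _ _ Ss st.
have : 0 <= energy z l (s * expR A).
  by apply: energy_ge0; [exact: lt_le_trans (ST _ Ss) st|rewrite /l; lra].
rewrite lnM ?posrE ?expR_gt0// expRK mulrDr.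
have -> : c * A = energy z l s + 1 by rewrite /A mulrCA divff ?mulr1// gt_eqF.
lra.
Unshelve. all: by end_near. Qed.

Lemma gap_littleo e : 3 < alpha -> 0 < e ->
  exists S, forall t, S < t -> t ^+ 3 * (f (v t) - f z) <= e.
Proof.
move=> a3 e0; have e4 : 0 < e / 4 by lra.
have [S [_ HS]] : \forall t \near +oo, mechanical z t <= e / 4.
  exact: (cvgr_le _ (mechanical_cvg0 a3)).
exists (Num.max T S) => t; rewrite gt_max => /andP[Tt /HS].
by have := mechanical_ge_gap Tt; lra.
Qed.

(** The energy for [l = 3] controls [k |v - z|^2], and [k > 0] because [alpha > 3]. *)
Lemma trajectory_bounded : 3 < alpha -> exists2 B, 0 <= B &
  forall t, T + 1 <= t -> `|v t - z| <= B.
Proof.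
move=> a3; have T1 : T < T + 1 by rewrite ltrDl.
pose k := 3 * (alpha - 3) / 2; have k0 : 0 < k by rewrite /k; lra.
pose E := energy z 3 (T + 1) / k.
have E0 : 0 <= E.
  by apply: divr_ge0 (ltW k0); apply: energy_ge0 => //; lra.
(* [E <= (E + 1)^2] avoids a square root. *)
exists (E + 1); first by lra.
move=> t tT; have Tt := lt_le_trans T1 tT.
apply: (norm_le_of_sqr ipP); first by lra.
have : ip (v t - z) (v t - z) <= E.
  rewrite /E ler_pdivlMr// mulrC.
  have := @energy_nincr 3 _ (T + 1) t T1 tT; rewrite lexx ltW// => /(_ isT).
  have := energy_ge 3 Tt; rewrite -/k.
  have : 0 <= t ^+ 3 / 4 * (f (v t) - f z).
    by rewrite mulr_ge0// divr_ge0// exprn_ge0// ltW// tgt0.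
  lra.
by nra.
Qed.

(** In the convergent [anchor] the cross term tends to [0]: [|v - z|] is bounded, and [t |v1|]
    vanishes in the limit together with [mechanical]. *)
Lemma distance_cvg : 3 < alpha -> cvg (ip (v t - z) (v t - z) @[t --> +oo]).
Proof.
move=> a3; have /cvg_ex[p Ep] := (mechanical_anchor_cvg a3).2.
have [B B0 HB] := trajectory_bounded a3.
have Z : t * ip (v t - z) (v1 t) @[t --> +oo] --> 0.
  apply/cvgrPdist_le => e e0; rewrite /=.
  pose e' := e / (B + 1); have e'0 : 0 < e' by rewrite divr_gt0//; lra.
  have hW : \forall t \near +oo, mechanical z t <= e' ^+ 2 / 2.
    by apply: (cvgr_le _ (mechanical_cvg0 a3)); rewrite divr_gt0// exprn_gt0.
  near=> t.
  have tT : T + 1 <= t by near: t; apply: nbhs_pinfty_ge; rewrite num_real.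
  have Tt : T < t by lra.
  have t0 := tgt0 Tt.
  have Wt : mechanical z t <= e' ^+ 2 / 2 by near: t.
  rewrite sub0r normrN normrM gtr0_norm//.
  have tv : t * `|v1 t| <= e'.
    have tv0 : 0 <= t * `|v1 t| by rewrite mulr_ge0// ltW.
    suff : (t * `|v1 t|) ^+ 2 <= e' ^+ 2 by rewrite ler_sqr ?nnegrE// ltW.
    by rewrite exprMn -(ip_norm ipP); have := mechanical_ge_speed Tt; lra.
  have := ip_CauchySchwarz ipP (v t - z) (v1 t).
  rewrite -(ler_pM2l t0) => /le_trans; apply.
  rewrite mulrCA; apply: (@le_trans _ _ ((B + 1) * e')).
    by apply: ler_pM => //; [rewrite mulr_ge0// ltW|have := HB _ tT; lra].
  by rewrite /e' mulrCA divff ?mulr1// gt_eqF//; lra.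
apply/cvg_ex; exists (2 / alpha * (p - 0)).
have -> : (fun t => ip (v t - z) (v t - z)) =
    fun t => 2 / alpha * (anchor z t - t * ip (v t - z) (v1 t)).
  by apply/funext => t; rewrite /anchor; field; rewrite gt_eqF//; lra.
by apply: cvgM; [exact: cvg_cst|exact: cvgB].
Unshelve. all: by end_near. Qed.

Lemma value_cvg : 3 < alpha -> f (v t) @[t --> +oo] --> f z.
Proof.
move=> a3; apply/cvgrPdist_le => e e0; have [S HS] := gap_littleo a3 e0.
near=> t.
have t1 : 1 <= t by near: t; apply: nbhs_pinfty_ge; rewrite num_real.
have /HS : S < t by near: t; apply: nbhs_pinfty_gt; rewrite num_real.
rewrite distrC ger0_norm//; apply: le_trans.
by rewrite ler_peMl// exprn_ege1.
Unshelve. all: by end_near. Qed.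

End Anchored.

Lemma trajectory_weak_cvg : 3 < alpha -> argmin f !=set0 ->
  exists2 x, argmin f x & forall y, ip (v t) y @[t --> +oo] --> ip x y.
Proof.
move=> a3 [z zmin]; have [B B0 HB] := trajectory_bounded zmin a3.
apply: (@opial _ _ _ ipP _ _ _ _ _ (B + `|z|)).
- near=> t.
  have tT : T + 1 <= t by near: t; apply: nbhs_pinfty_ge; rewrite num_real.
  by rewrite -[v t](subrK z); apply: le_trans (ler_normD _ _) _; rewrite lerD2r HB.
- by move=> z' zmin'; exact: distance_cvg.
(* Weak limits are minimizers: pass to the limit along [G] in [f x + ip (g x) (v t - x) <= f (v t)],
   whose right-hand side tends to [f z]. *)
- move=> G x GU FG xG y; apply: le_trans (zmin y).
  have vG : f (v t) @[t --> G] --> f z.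
    by move=> A /(value_cvg zmin a3)/FG.
  have lG : f x + (ip (v t) (g x) - ip x (g x)) @[t --> G] -->
            f x + (ip x (g x) - ip x (g x)).
    by apply: cvgD (cvg_cst _) _; apply: cvgB (xG _) (cvg_cst _).
  rewrite subrr addr0 in lG; apply: (ler_cvg_to lG vG).
  apply: filterE => t; rewrite -(ipBl ipP) (ip_sym ipP).
  exact: convex_gradient_le cf gf.
Unshelve. all: by end_near. Qed.

End Dynamics.

(* Convexity at [u t] makes [t^4 (f (u t) - f z)] grow at rate at most
   [4 t^3 (f (v t) - f z)], where [v t = u t + (t / 4) u' t]. *)
Lemma average_gap_le {R : realType} {V : normedModType R} (ip : V -> V -> R)
    (f : V -> R) (g : V -> V) (u u1 : R -> V) (z : V) (T c e : R) :
  inner_product ip -> convex_function setT f -> is_gradient ip f g ->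
  0 <= T -> 0 <= c ->
  (forall t, T < t -> is_derive t (1 : R) u (u1 t)) ->
  (forall t, T < t -> t ^+ 3 * (f (u t + (t / 4) *: u1 t) - f z) <= c) ->
  0 < e ->
  exists S, forall t, S < t -> t ^+ 3 * (f (u t) - f z) <= 4 * c + e.
Proof.
move=> ipP cf gf T0 c0 Du vc e0.
pose h t := 1 * t ^+ 4 * (f (u t) - f z).
have hle s t : T < s -> s <= t -> h t <= h s + 4 * c * (t - s).
  apply: (@is_derive1_le_cst _ h (fun r => 1 * (4%:R * r ^+ 3) * (f (u r) - f z)
            + 1 * r ^+ 4 * ip (g (u r)) (u1 r))) => r Tr.
    apply: is_derive1_mul; first exact: is_derive1_monomial.
    by apply: is_derive1_sub_cst; apply: (is_derive1_gradient gf); exact: Du.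
  have r0 : 0 < r by lra.
  have := vc _ Tr.
  have := convex_gradient_le (u r) (u r + (r / 4) *: u1 r) cf gf.
  rewrite addrAC subrr add0r (ipZr ipP) => le1 le2.
  have : r ^+ 3 * (f (u r) + r / 4 * ip (g (u r)) (u1 r) - f z) <= c.
    by apply: le_trans le2; rewrite ler_pM2l ?exprn_gt0//; lra.
  move=> le3; apply: (@le_trans _ _ (4 *
    (r ^+ 3 * (f (u r) + r / 4 * ip (g (u r)) (u1 r) - f z)))); last by lra.
  by rewrite le_eqVlt; apply/orP; left; apply/eqP; field.
pose s := T + 1; have Ts : T < s by rewrite ltrDl.
(* Past this time [h s <= e * t], so [h t <= (4 * c + e) * t]; dividing by [t] gives the claim. *)
exists (Num.max s (`|h s| / e)) => t; rewrite gt_max => /andP[st te].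
have t0 : 0 < t by lra.
rewrite -(ler_pM2r t0).
have := hle s t Ts (ltW st); rewrite {1}/h.
move: te; rewrite ltr_pdivrMr// => te; have := ler_norm (h s).
have : 0 <= 4 * c * s by rewrite mulr_ge0//; lra.
have -> : 1 * t ^+ 4 * (f (u t) - f z) = t ^+ 3 * (f (u t) - f z) * t by ring.
move: (h s) te => q te; lra.
Qed.

(** * Reduction of (TOGES-V) to the shifted trajectory *)

Lemma inf_range_argmin {R : realType} {V : Type} (f : V -> R) z :
  argmin f z -> inf (range f) = f z.
Proof.
move=> zmin; apply/eqP; rewrite eq_le; apply/andP; split.
  by apply: ge_inf; [exists (f z) => _ [x _ <-]|exists z].
by apply: lb_le_inf; [exists (f z), z|move=> _ [x _ <-]].
Qed.

Lemma norm_le_inv_cube {R : realType} (x c t : R) : 0 < t -> 0 <= x ->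
  t ^+ 3 * x <= c -> `|x| <= c * `|t ^- 3|.
Proof.
move=> t0 x0 xc; rewrite !ger0_norm//; last by rewrite invr_ge0 exprn_ge0// ltW.
by rewrite ler_pdivlMr ?exprn_gt0// mulrC.
Qed.

Theorem theorem2p1 (R : realType) (H : completeNormedModType R)
  (ip : H -> H -> R) (f : H -> R) (gradf : H -> H)
  (t0 alpha : R) (u : R -> H) :
  inner_product ip ->
  convex_function setT f ->
  is_gradient ip f gradf ->
  continuous gradf ->
  argmin f !=set0 ->
  0 < t0 -> 0 <= alpha ->
  (* u is a classical C^3 solution of (TOGES-V) on ]t0, +oo[ *)
  (forall t, t0 < t ->
     [/\ derivable u t 1, derivable (derive1 u) t 1, derivable (derive1 (derive1 u)) t 1
       & {for t, continuous (derive1 (derive1 (derive1 u)))}]) ->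
  (forall t, t0 < t ->
     derive1 (derive1 (derive1 u)) t + ((alpha + 7) / t) *: derive1 (derive1 u) t
     + ((5 * (alpha + 1)) / t ^+ 2) *: derive1 u t
     + gradf (u t + (t / 4) *: derive1 u t) = 0) ->
  (3 <= alpha ->
     bigO_pinfty (fun t => f (u t + (t / 4) *: derive1 u t) - inf (range f))
                 (fun t => t ^-3)
  /\ bigO_pinfty (fun t => f (u t) - inf (range f)) (fun t => t ^-3)) /\
  (3 < alpha ->
     [/\ littleo_pinfty (fun t => f (u t + (t / 4) *: derive1 u t) - inf (range f))
                        (fun t => t ^-3),
         littleo_pinfty (fun t => f (u t) - inf (range f)) (fun t => t ^-3)
       & exists2 uinf : H, argmin f uinf &
           forall y : H, ip (u t) y @[t --> +oo] --> ip uinf y]).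
Proof.
move=> ipP cf gf _ fmin t0_gt0 _ uC3 uode.
have [z zmin] := fmin; rewrite (inf_range_argmin zmin).
pose u1 := derive1 u; pose u2 := derive1 u1; pose u3 := derive1 u2.
have D (w : R -> H) t : derivable w t 1 -> is_derive t (1 : R) w (derive1 w t).
  by move=> dw; split => //; rewrite derive1E.
have Du t : t0 < t -> is_derive t (1 : R) u (u1 t) by move=> /uC3[/D].
have Du1 t : t0 < t -> is_derive t (1 : R) u1 (u2 t) by move=> /uC3[_ /D].
have Du2 t : t0 < t -> is_derive t (1 : R) u2 (u3 t) by move=> /uC3[_ _ /D].
have D4 t : is_derive t (1 : R) (fun s => s / 4) 4^-1.
  have := is_derive1_monomial 1 4^-1 t; rewrite expr0 !mulr1.
  by under eq_fun do rewrite expr1 mulrC.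
(* [v1] and [v2] are the derivatives of [v]: [5 / 4 = 1 + 1 / 4] and [3 / 2 = 5 / 4 + 1 / 4]. *)
pose v t := u t + (t / 4) *: u1 t.
pose v1 t := (5 / 4) *: u1 t + (t / 4) *: u2 t.
pose v2 t := (3 / 2) *: u2 t + (t / 4) *: u3 t.
have Dv t : t0 < t -> is_derive t (1 : R) v (v1 t).
  move=> t0t.
  apply: is_derive_eq (is_derive1_add (Du _ t0t)
    (is_derive1_scale (D4 t) (Du1 _ t0t))) _.
  by rewrite /v1; apply: (ip_ext ipP) => w; rewrite !(ipE ipP); field.
have Dv1 t : t0 < t -> is_derive t (1 : R) v1 (v2 t).
  move=> t0t.
  apply: is_derive_eq (is_derive1_add (is_deriveZ (5 / 4) (Du1 _ t0t))
    (is_derive1_scale (D4 t) (Du2 _ t0t))) _.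
  by rewrite /v2; apply: (ip_ext ipP) => w; rewrite !(ipE ipP); field.
(* This is (TOGES-V) multiplied by [t^2 / 4]. *)
have ode t : t0 < t ->
    t *: v2 t + (alpha + 1) *: v1 t + (t ^+ 2 / 4) *: gradf (v t) = 0.
  move=> t0t; have tn0 : t != 0 by rewrite gt_eqF// (lt_trans t0_gt0).
  apply: (ip_ext ipP) => w; have /(congr1 (ip ^~ w)) := uode _ t0t.
  rewrite -/u1 -/u2 -/u3 -/(v t) /v1 /v2 !(ipE ipP) => E.
  by rewrite -[RHS](mulr0 (t ^+ 2 / 4)) -E; field.
have t0_ge0 := ltW t0_gt0.
have t0S S t : Num.max t0 S < t -> 0 < t /\ S < t.
  by rewrite gt_max => /andP[/(lt_trans t0_gt0)].
have gap0 x : 0 <= f x - f z by rewrite subr_ge0.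
split=> [a3|a3].
  have [C HC] := gap_bigO ipP cf gf t0_ge0 Dv Dv1 ode zmin a3.
  split.
    exists C, (t0 + 1) => t tt.
    by apply: norm_le_inv_cube (HC _ (ltW tt)) => //; lra.
  have C0 : 0 <= C.
    by apply: le_trans (HC _ (lexx _)); rewrite mulr_ge0// exprn_ge0//; lra.
  have t1 : 0 <= t0 + 1 by lra.
  have Du' t : t0 + 1 < t -> is_derive t (1 : R) u (u1 t).
    by move=> tt; apply: Du; lra.
  have [S HS] := average_gap_le ipP cf gf t1 C0 Du'
    (fun t tt => HC t (ltW tt)) (@ltr01 R).
  exists (4 * C + 1), (Num.max t0 S) => t /t0S[tpos St].
  by apply: norm_le_inv_cube => //; exact: HS.
have lo e : 0 < e -> exists S, forall t, S < t -> t ^+ 3 * (f (v t) - f z) <= e.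
  exact: (gap_littleo ipP cf gf t0_ge0 Dv Dv1 ode zmin a3).
split.
- move=> e /lo[S HS]; exists (Num.max t0 S) => t /t0S[tpos St].
  by apply: norm_le_inv_cube => //; exact: HS.
(* [average_gap_le] turns the bound [e / 8] for [v], with slack [e / 2], into
   [4 * (e / 8) + e / 2 = e] for [u]. *)
- move=> e e0; have e8 : 0 < e / 8 by lra.
  have [S HS] := lo _ e8; pose T := Num.max t0 S.
  have T0 : 0 <= T by rewrite le_max t0_ge0.
  have Du' t : T < t -> is_derive t (1 : R) u (u1 t).
    by rewrite gt_max => /andP[/Du].
  have vT t : T < t -> t ^+ 3 * (f (u t + (t / 4) *: u1 t) - f z) <= e / 8.
    by rewrite gt_max => /andP[_ /HS].
  have e2 : 0 < e / 2 by lra.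
  have [S' HS'] := average_gap_le ipP cf gf T0 (ltW e8) Du' vT e2.
  exists (Num.max t0 S') => t /t0S[tpos St].
  by apply: norm_le_inv_cube => //; have := HS' _ St; lra.
- have [x xmin vx] := trajectory_weak_cvg ipP cf gf t0_ge0 Dv Dv1 ode a3 fmin.
  exists x => // y.
  (* For fixed [y], [ip (u t) y] is the weighted average of [ip (v t) y], so it inherits the
     limit. *)
  apply: (@average_cvg _ (fun t => ip (u t) y) (fun t => ip (v t) y)
            (fun t => ip (u1 t) y) t0) => // t t0t.
    have := is_derive1_ip ipP (Du _ t0t) (is_derive_cst y t (1 : R)).
    by rewrite (ip0r ipP) addr0.
  by rewrite /v (ipDl ipP) (ipZl ipP).
Qed.
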